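(* Let $\mathcal{B}$ be a $C^*$-algebra and let $E$ be a Hilbert $\mathcal{B}$-module. For a subset $K\subset E$ the following conditions are equivalent: 1. $K$ is an ideal submodule of $E$. 2. $K$ is a closed ternary ideal in $E$.
   Context: Hilbert modules are right modules with $\mathcal{B}$-valued inner product $\langle\cdot,\cdot\rangle$, linear in the second variable; they need not be full. For sets $A,B$ for which products (or inner products) of elements are defined, $AB=\{ab: a\in A, b\in B\}$ and $\langle A,B\rangle=\{\langle a,b\rangle: a\in A,b\in B\}$ (just sets, no span or closure); $\overline{\mathrm{span}}$ denotes closed linear span. A subset $K\subset E$ is an ideal submodule of $E$ if $K=\overline{\mathrm{span}}\,EI$ for some closed (two-sided) ideal $I$ in $\mathcal{B}$. A linear subspace $K$ of $E$ is a ternary ideal if $E\langle K,E\rangle\subset K$, i.e. $x\langle k,y\rangle\in K$ for all $x,y\in E$, $k\in K$. *)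

(* Defs.v *)
From HB Require Import structures.
From mathcomp Require Import all_boot all_order all_algebra.
From mathcomp Require Import complex.
From mathcomp Require Import all_classical all_reals all_analysis.

Set Implicit Arguments.
Unset Strict Implicit.
Unset Printing Implicit Defensive.

Import Order.TTheory GRing.Theory Num.Theory.
Import numFieldNormedType.Exports.

Local Open Scope classical_set_scope.
Local Open Scope complex_scope.
Local Open Scope ring_scope.

(* Algebras are not required to be unital, so the product cannot come from
   MathComp's ring structures.  The norm has values in the nonnegative reals
   of R[i]. *)
HB.mixin Record isCstarAlgebra (R : realType) B
    of CompleteNormedModule R[i] B := {
  cmul : B -> B -> B;
  star : B -> B;
  cmulA : associative cmul;
  cmulDl : left_distributive cmul +%R;
  cmulDr : right_distributive cmul +%R;
  cmulZl : forall (z : R[i]) (a b : B), cmul (z *: a) b = z *: cmul a b;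
  cmulZr : forall (z : R[i]) (a b : B), cmul a (z *: b) = z *: cmul a b;
  starD : {morph star : a b / a + b};
  starZ : forall (z : R[i]) (a : B), star (z *: a) = (z^*)%C *: star a;
  starM : forall a b : B, star (cmul a b) = cmul (star b) (star a);
  starK : involutive star;
  cnormM : forall a b : B, `|cmul a b| <= `|a| * `|b|;
  cnorm_star : forall a : B, `|cmul (star a) a| = `|a| ^+ 2
}.

#[short(type="cstarAlgType")]
HB.structure Definition CstarAlgebra (R : realType) :=
  {B of isCstarAlgebra R B & CompleteNormedModule R[i] B}.

Definition cpositive (R : realType) (B : cstarAlgType R) (a : B) : Prop :=
  exists b : B, a = cmul (star b) b.

(* Requiring the ambient complete norm to be the one induced by the inner
   product (norm_inner) expresses the completeness of a Hilbert module; it also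
   makes the inner product definite, see inner_eq0 below. *)
HB.mixin Record isHilbertModule (R : realType) (B : cstarAlgType R) E
    of CompleteNormedModule R[i] E := {
  act : E -> B -> E;
  inner : E -> E -> B;
  actA : forall (x : E) (a b : B), act (act x a) b = act x (cmul a b);
  actDl : forall (x y : E) (b : B), act (x + y) b = act x b + act y b;
  actDr : forall (x : E) (a b : B), act x (a + b) = act x a + act x b;
  actZl : forall (z : R[i]) (x : E) (b : B), act (z *: x) b = z *: act x b;
  actZr : forall (z : R[i]) (x : E) (b : B), act x (z *: b) = z *: act x b;
  innerDr : forall x y y' : E, inner x (y + y') = inner x y + inner x y';
  innerZr : forall (z : R[i]) (x y : E), inner x (z *: y) = z *: inner x y;
  inner_act : forall (x y : E) (b : B), inner x (act y b) = cmul (inner x y) b;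
  star_inner : forall x y : E, star (inner x y) = inner y x;
  inner_ge0 : forall x : E, cpositive (inner x x);
  norm_inner : forall x : E, `|x| ^+ 2 = `|inner x x|
}.

#[short(type="hilbertModType")]
HB.structure Definition HilbertModule (R : realType) (B : cstarAlgType R) :=
  {E of isHilbertModule R B E & CompleteNormedModule R[i] E}.

Lemma inner_eq0 (R : realType) (B : cstarAlgType R) (E : hilbertModType B)
  (x : E) : inner x x = 0 -> x = 0.
Proof.
move=> xx0; apply/normr0_eq0/eqP.
by rewrite -sqrf_eq0 norm_inner xx0 normr0.
Qed.

Section Subspaces.
Context {K : numFieldType} {V : normedModType K}.
Implicit Type A : set V.

Definition linear_subspace A : Prop := submod_closed [in A].

Definition lin_span A : set V := smallest linear_subspace A.

Definition closed_span A : set V := closure (lin_span A).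

End Subspaces.

Definition closed_ideal (R : realType) (B : cstarAlgType R) (I : set B)
    : Prop :=
  [/\ closed I, linear_subspace I,
      forall a b : B, I b -> I (cmul a b)
    & forall a b : B, I a -> I (cmul a b)].

Definition ideal_submodule (R : realType) (B : cstarAlgType R)
    (E : hilbertModType B) (K : set E) : Prop :=
  exists2 I : set B, closed_ideal I &
    K = closed_span [set act x b | x in [set: E] & b in I].

Definition ternary_ideal (R : realType) (B : cstarAlgType R)
    (E : hilbertModType B) (K : set E) : Prop :=
  linear_subspace K /\ forall x k y : E, K k -> K (act x (inner k y)).

(* Main.v *)
Require Import Defs.
From HB Require Import structures.
From mathcomp Require Import all_boot all_order all_algebra.
From mathcomp Require Import complex ring.
From mathcomp Require Import all_classical all_reals all_analysis.

Set Implicit Arguments.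
Unset Strict Implicit.
Unset Printing Implicit Defensive.

Import Order.TTheory GRing.Theory Num.Theory.
Import numFieldNormedType.Exports.

Local Open Scope classical_set_scope.
Local Open Scope complex_scope.
Local Open Scope ring_scope.

(* Everything rests on the fact that every x in a Hilbert module is a limit of
   elements x<x,y>.  Put h = <x,x>.  For a polynomial q with real coefficients
   and q(0) = 1 write 1 - q = X p and y = x p(h); then x - x<x,y> = x q(h), of
   squared norm |h q(h)^2|, so it suffices to make the latter small.  This is
   done without unit, spectrum or functional calculus: the C*-identity applied
   to almost unitary polynomials in h shows that the powers of 1 - 2h^2/n^2 are
   bounded by 2 up to exponent n^3, and q is the average of these powers, so
   that X^2 q telescopes and h^2 q(h) = O(1/n).

   Consequently a closed ternary ideal K is a right B-submodule, which makes
   the closed span I of <K,E> an ideal, and K is the closed span of EI.  Conversely,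
   closed ideals are self-adjoint (apply the fact to B as a module over
   itself), whence <xb,y> = b^*<x,y> lies in I for b in I. *)

(** * Scalar estimates *)

Lemma expr1D_le2 (F : numDomainType) (x : F) n :
  0 <= x -> x *+ (2 * n) <= 1 -> (1 + x) ^+ n <= 2.
Proof.
(* The linear bound survives induction: the quadratic term [x * (x *+ (2 * n))] is at most [x],
   which the slack in the factor 2 absorbs. *)
move=> x0 nx; suff: (1 + x) ^+ n <= 1 + x *+ (2 * n).
  by move/le_trans; apply; rewrite lerD2l.
elim: n nx => [|n IH] nx; first by rewrite expr0 muln0 mulr0n addr0.
have {}nx : x *+ (2 * n) <= 1.
  by apply: le_trans nx; rewrite ler_wpMn2l// leq_mul.
rewrite exprS; apply: (@le_trans _ _ ((1 + x) * (1 + x *+ (2 * n)))).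
  by rewrite ler_wpM2l ?IH// addr_ge0.
rewrite mulnS; move: (2 * n)%N nx => k kx.
rewrite mulrDl mul1r mulrDr mulr1 mulrnDr mulr2n -!addrA lerD2l.
by rewrite [leLHS]addrC -!addrA lerD2l lerD2r ler_piMr.
Qed.

Lemma complex_natr_ge (R : realType) (x : R[i]) :
  0 <= x -> exists n : nat, x <= n%:R.
Proof.
move=> x0; have xr : x \is Num.real by exact: ger0_real.
exists (Num.bound (complex.Re x)); rewrite -(RRe_real xr).
rewrite -[_%:R](rmorph_nat (real_complex R)) lecR.
by apply/ltW/archi_boundP; rewrite -ler0c RRe_real.
Qed.

Lemma conjc_ge0 (R : realType) (x : R[i]) : 0 <= x -> x^*%C = x.
Proof. by move=> x0; apply/CrealP; exact: ger0_real. Qed.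

(** * Polynomials in a linear operator, applied to a vector *)

Section PolyOp.
Context {K : comNzRingType} {V : lmodType K} (A : {linear V -> V}).
Implicit Types (p q : {poly K}) (v w : V).

(** This is p(A)v. Iterating on a vector gives the constant term a meaning even when [A] is
    multiplication in an algebra without unit. *)
Definition poly_op p v : V := \sum_(i < size p) p`_i *: iter i A v.

Lemma poly_opE n p v : (size p <= n)%N ->
  poly_op p v = \sum_(i < n) p`_i *: iter i A v.
Proof.
move=> pn; rewrite /poly_op (big_ord_widen n (fun i => p`_i *: iter i A v) pn).
rewrite big_mkcond; apply: eq_bigr => i _; case: ltnP => // ip.
by rewrite nth_default // scale0r.
Qed.

Lemma poly_opD p q v : poly_op (p + q) v = poly_op p v + poly_op q v.
Proof.
set n := maxn (size p) (size q).
rewrite (@poly_opE n) ?size_polyD// (@poly_opE n p) ?leq_maxl//.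
rewrite (@poly_opE n q) ?leq_maxr// -big_split /=.
by apply: eq_bigr => i _; rewrite coefD scalerDl.
Qed.

Lemma poly_opZ c p v : poly_op (c *: p) v = c *: poly_op p v.
Proof.
rewrite (@poly_opE (size p)) ?size_scale_leq// scaler_sumr.
by apply: eq_bigr => i _; rewrite coefZ scalerA.
Qed.

Lemma poly_op0 v : poly_op 0 v = 0.
Proof. by rewrite /poly_op size_poly0 big_ord0. Qed.

Lemma poly_op1 v : poly_op 1 v = v.
Proof. by rewrite /poly_op size_poly1 big_ord1 coef1 scale1r. Qed.

Lemma poly_opMX p v : poly_op (p * 'X) v = poly_op p (A v).
Proof.
rewrite (@poly_opE (size p).+1); last first.
  have [->|/size_mulX->//] := eqVneq p 0; by rewrite mul0r size_poly0.
rewrite big_ord_recl coefMX scale0r add0r; apply: eq_bigr => i _.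
by rewrite coefMX /= -iterS iterSr.
Qed.

Lemma poly_op_linear p : linear (poly_op p).
Proof.
have itl i : linear (iter i A).
  by elim: i => [//|i IH] c v w; rewrite !iterS IH linearP.
move=> c v w; rewrite /poly_op scaler_sumr -big_split; apply: eq_bigr => i _.
by rewrite itl scalerDr !scalerA mulrC.
Qed.

HB.instance Definition _ p :=
  GRing.isLinear.Build K V V *:%R (poly_op p) (poly_op_linear p).

Lemma poly_opM p q v : poly_op (p * q) v = poly_op p (poly_op q v).
Proof.
elim/poly_ind: q v => [|q c IH] v; first by rewrite mulr0 !poly_op0 linear0.
rewrite mulrDr mulrA !poly_opD !poly_opMX IH mulrC mul_polyC poly_opZ.
by rewrite -[c%:P]alg_polyC poly_opZ poly_op1 linearD linearZ.
Qed.

Lemma poly_op_comm p v : A (poly_op p v) = poly_op p (A v).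
Proof.
rewrite /poly_op linear_sum; apply: eq_bigr => i _.
by rewrite linearZ -iterS iterSr.
Qed.

End PolyOp.

(** * Basic facts on C*-algebras *)

Section CstarTheory.
Context {R : realType} {B : cstarAlgType R}.
Implicit Types (a b c d : B) (p q : {poly R[i]}).

Lemma cmul_linear a : linear (cmul a).
Proof. by move=> z b c; rewrite cmulDr cmulZr. Qed.

HB.instance Definition _ a :=
  GRing.isLinear.Build R[i] B B *:%R (cmul a) (cmul_linear a).

Lemma cmul0l a : cmul 0 a = 0.
Proof. by apply: (addrI (cmul 0 a)); rewrite -cmulDl !addr0. Qed.

Lemma star0 : star (0 : B) = 0.
Proof. by apply: (addrI (star 0)); rewrite -starD !addr0. Qed.

(** The C*-identity and submultiplicativity give |b|^2 <= |b^*| |b|; use this for [a] and for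
    [star a]. *)
Lemma cnorm_starE a : `|star a| = `|a|.
Proof.
have le b : `|b| <= `|star b|.
  have := cnormM (star b) b; rewrite cnorm_star expr2.
  have [->|b0] := eqVneq b 0; first by rewrite normr0 normr_ge0.
  by rewrite ler_pM2r ?normr_gt0.
by apply/eqP; rewrite eq_le le -{2}[a]starK le.
Qed.

End CstarTheory.

(** * Norm bounds for polynomials in a self-adjoint element *)

Section SelfAdjoint.
Context {R : realType} {B : cstarAlgType R} (h : B).
Implicit Types (a b c d : B) (p q : {poly R[i]}).

Let ev := poly_op (cmul h).
Let conjp p := map_poly (@conjc R) p.

Lemma iter_cmull i c d :
  cmul (iter i (cmul h) c) d = iter i (cmul h) (cmul c d).
Proof. by elim: i => //= i <-; rewrite cmulA. Qed.

Lemma iter_cmulr i : cmul (iter i (cmul h) h) h = iter i.+1 (cmul h) h.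
Proof. by rewrite iter_cmull iterSr. Qed.

Lemma poly_op_cmull p c d : cmul (ev p c) d = ev p (cmul c d).
Proof.
rewrite /ev /poly_op (big_morph (cmul^~ d) (id1 := 0) (op1 := +%R)).
- by apply: eq_bigr => i _; rewrite cmulZl iter_cmull.
- by move=> a b; rewrite cmulDl.
- exact: cmul0l.
Qed.

Context (h_sa : star h = h).

Lemma star_iter_cmul i : star (iter i (cmul h) h) = iter i (cmul h) h.
Proof. by elim: i => // i IH; rewrite iterS starM h_sa IH iter_cmulr. Qed.

Lemma poly_op_conjE p c :
  ev (conjp p) c = \sum_(i < size p) (p`_i)^*%C *: iter i (cmul h) c.
Proof.
rewrite /ev (@poly_opE _ _ _ (size p)) ?size_poly//.
by apply: eq_bigr => i _; rewrite coef_map_id0 // rmorph0.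
Qed.

Lemma star_poly_op p : star (ev p h) = ev (conjp p) h.
Proof.
rewrite poly_op_conjE /ev /poly_op (big_morph _ starD star0).
by apply: eq_bigr => i _; rewrite starZ star_iter_cmul.
Qed.

Lemma poly_op_adjoint p c d :
  cmul (star (ev p c)) d = cmul (star c) (ev (conjp p) d).
Proof.
have it i : cmul (star (iter i (cmul h) c)) d =
            cmul (star c) (iter i (cmul h) d).
  elim: i d => // i IH e.
  by rewrite iterS starM h_sa -cmulA IH -iterSr.
rewrite poly_op_conjE linear_sum /ev /poly_op (big_morph _ starD star0).
rewrite (big_morph (cmul^~ d) (id1 := 0) (op1 := +%R)).
- by apply: eq_bigr => i _; rewrite starZ cmulZl it linearZ.
- by move=> a b; rewrite cmulDl.
- exact: cmul0l.
Qed.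

(** The C*-identity for [ev p h], which is h p(h): of the two factors h in the product, one stays as
    the argument and the other becomes ['X]. *)
Lemma sqr_norm_poly_op p : `|ev p h| ^+ 2 = `|ev (conjp p * (p * 'X)) h|.
Proof.
rewrite -cnorm_star star_poly_op poly_op_cmull.
by rewrite /ev poly_op_comm poly_opM poly_opMX.
Qed.

(** A bound on p(h) as a multiplication operator on B, since p(h) itself need not lie in B when p
    has a constant term. *)
Definition poly_op_bound (M : R[i]) p := forall c, `|ev p c| <= M * `|c|.

Lemma poly_op_boundW M M' p :
  M <= M' -> poly_op_bound M p -> poly_op_bound M' p.
Proof.
by move=> MM' Mp c; apply: le_trans (Mp c) _; rewrite ler_wpM2r.
Qed.

Lemma poly_op_boundD M N p q : poly_op_bound M p -> poly_op_bound N q ->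
  poly_op_bound (M + N) (p + q).
Proof.
move=> Mp Nq c; rewrite /ev poly_opD mulrDl.
exact: le_trans (ler_normD _ _) (lerD (Mp c) (Nq c)).
Qed.

Lemma poly_op_boundZ M z p : poly_op_bound M p ->
  poly_op_bound (`|z| * M) (z *: p).
Proof.
by move=> Mp c; rewrite /ev poly_opZ normrZ -mulrA ler_wpM2l.
Qed.

Lemma poly_op_boundM M N p q : 0 <= M ->
  poly_op_bound M p -> poly_op_bound N q -> poly_op_bound (M * N) (p * q).
Proof.
move=> M0 Mp Nq c; rewrite /ev poly_opM -mulrA.
by apply: le_trans (Mp _) _; rewrite ler_wpM2l//; exact: Nq.
Qed.

Lemma poly_op_bound1 : poly_op_bound 1 1.
Proof. by move=> c; rewrite /ev poly_op1 mul1r. Qed.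

Lemma poly_op_boundX : poly_op_bound `|h| 'X.
Proof. by move=> c; rewrite -['X]mul1r /ev poly_opMX poly_op1 cnormM. Qed.

Lemma poly_op_boundXn M p n : 0 <= M ->
  poly_op_bound M p -> poly_op_bound (M ^+ n) (p ^+ n).
Proof.
move=> M0 Mp; elim: n => [|n IH]; first exact: poly_op_bound1.
by rewrite !exprS; exact: poly_op_boundM.
Qed.

Lemma poly_op_bound_sum M (F : nat -> {poly R[i]}) n :
  (forall k, (k < n)%N -> poly_op_bound M (F k)) ->
  poly_op_bound (M *+ n) (\sum_(k < n) F k).
Proof.
elim: n => [|n IH] MF.
  by move=> c; rewrite big_ord0 /ev poly_op0 normr0 mulr0n mul0r.
rewrite big_ord_recr mulrSr; apply: poly_op_boundD; last exact: MF.
by apply: IH => k kn; apply: MF; rewrite ltnW.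
Qed.

(* The unit-free form of the C*-identity ||p(h)||^2 = ||p(h)^* p(h)||. *)
Lemma poly_op_bound_sqr M p : 0 <= M ->
  poly_op_bound (M ^+ 2) (conjp p * p) -> poly_op_bound M p.
Proof.
move=> M0 Mp c; rewrite -(@ler_pXn2r _ 2) ?nnegrE ?mulr_ge0//.
rewrite -cnorm_star poly_op_adjoint -[ev (conjp p) _]poly_opM.
apply: le_trans (cnormM _ _) _; rewrite cnorm_starE.
by rewrite exprMn [in leRHS]mulrC -mulrA ler_wpM2l// mulrC; exact: Mp.
Qed.

(** The second-order truncation of cos(2rX). *)
Let T (r : R[i]) : {poly R[i]} := 1 - (2 * r ^+ 2) *: 'X^2.

Lemma conj_polyT r : 0 <= r -> conjp (T r) = T r.
Proof.
move=> r0; rewrite /conjp /T rmorphB rmorph1 /= map_polyZ map_polyXn.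
by congr (_ - _ *: _); apply: conjc_ge0; rewrite mulr_ge0// exprn_ge0.
Qed.

(* [T r] is the real part of [u = T r + 2ir'X], and [u] is unitary up to
   fourth order in [r]: [u^* u = 1 + 4 r^4 'X^4]. *)
Lemma poly_op_boundT r : 0 <= r ->
  poly_op_bound (1 + 4 * r ^+ 4 * `|h| ^+ 4) (T r).
Proof.
move=> r0; set N := 1 + _.
have N1 : 1 <= N by rewrite lerDl !mulr_ge0// exprn_ge0.
have N0 : 0 <= N by exact: le_trans N1.
pose u (e : R[i]) : {poly R[i]} := T r + (e * 2 * r) *: 'X.
have uu : u 'i * u (- 'i) = 1 + (4 * r ^+ 4) *: 'X^4.
  rewrite /u /T -!mul_polyC.
  have i2 : (('i : R[i])%:P) ^+ 2 = -1 :> {poly R[i]}.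
    by rewrite -rmorphXn /= sqrCi rmorphN1.
  rewrite !(polyC_exp, polyCM) polyCN !polyC_natr.
  (* [ring] treats the imaginary unit as a variable, so the terms that cancel through its square are
     collected behind the factor 1 + i^2. *)
  transitivity (1 + 4 * r%:P ^+ 4 * 'X^4 -
    4 * (1 + 'i%:P ^+ 2) * r%:P ^+ 2 * 'X^2 : {poly R[i]}); first by ring.
  by rewrite i2; ring.
have conju e : conjp (u e) = u e^*%C.
  rewrite /conjp rmorphD /= map_polyZ map_polyX.
  congr (_ + _ *: _); first exact: conj_polyT.
  by rewrite !rmorphM; congr (_ * _ * _); exact: conjc_ge0.
have conji : ('i : R[i])^*%C = - 'i by exact: (conjCi R[i]).
have bu e : conjp (u e) * u e = u 'i * u (- 'i) -> poly_op_bound N (u e).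
  move=> ue; apply: poly_op_bound_sqr => //; rewrite ue uu.
  (* As [1 <= N], the bound [N] implies the required [N ^+ 2], and no square root has to be
     taken. *)
  apply: (@poly_op_boundW N); first by rewrite expr2 ler_peMr.
  apply: poly_op_boundD; first exact: poly_op_bound1.
  rewrite -{1}[4 * r ^+ 4]ger0_norm ?mulr_ge0 ?exprn_ge0//.
  apply: poly_op_boundZ; apply: poly_op_boundXn => //; exact: poly_op_boundX.
have -> : T r = 2^-1 *: (u 'i + u (- 'i)).
  rewrite /u addrACA -scalerDl !mulNr addrN scale0r addr0 -(mulr2n (T r)).
  by rewrite -(scaler_nat 2 (T r)) scalerA mulVf ?scale1r// pnatr_eq0.
have -> : N = `|2^-1| * (N + N).
  by rewrite ger0_norm ?invr_ge0// -mulr2n -[N *+ 2]mulr_natl mulKf ?pnatr_eq0.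
apply: poly_op_boundZ; apply: poly_op_boundD; apply: bu.
  by rewrite conju conji mulrC.
by rewrite conju -conji conjcK conji.
Qed.

(** The excess over 1 in the bound for [T r] is of order r^4, so r^(-3) factors accumulate only 8
    |h|^4 r <= 1 in the hypothesis of [expr1D_le2]. *)
Lemma poly_op_boundT_expr n k : 8 * `|h| ^+ 4 <= n.+1%:R ->
  (k <= n.+1 ^ 3)%N -> poly_op_bound 2 (T n.+1%:R^-1 ^+ k).
Proof.
move=> hn kn; set r := n.+1%:R^-1.
have r0 : 0 <= r by rewrite invr_ge0.
have x0 : 0 <= 4 * r ^+ 4 * `|h| ^+ 4 by rewrite !mulr_ge0// exprn_ge0.
apply: poly_op_boundW (poly_op_boundXn k _ (poly_op_boundT r0)); last first.
  by rewrite addr_ge0.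
apply: expr1D_le2 => //.
apply: (@le_trans _ _ ((4 * r ^+ 4 * `|h| ^+ 4) *+ (2 * n.+1 ^ 3))).
  by rewrite ler_wpMn2l// leq_mul.
rewrite -mulr_natl natrM natrX.
have -> : 2 * n.+1%:R ^+ 3 * (4 * r ^+ 4 * `|h| ^+ 4) =
    r * (8 * `|h| ^+ 4) :> R[i].
  by rewrite /r; field; rewrite nat1r pnatr_eq0.
by rewrite /r mulrC ler_pdivrMr ?mul1r// ltr0Sn.
Qed.

Lemma approx_unit_poly (e : R[i]) : 0 < e ->
  exists q, [/\ conjp q = q, q.[0] = 1 & `|ev (q ^+ 2) h| < e].
Proof.
move=> e0.
(* The first summand is for [poly_op_boundT_expr]; the second makes the final bound 2^8 |h^2| / (n +
   1) smaller than e^4. *)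
have [n hn] : exists n : nat,
    8 * `|h| ^+ 4 + 2 ^+ 8 * `|cmul h h| / e ^+ 4 <= n%:R.
  apply: complex_natr_ge; rewrite addr_ge0 ?mulr_ge0 ?exprn_ge0//.
  by rewrite invr_ge0 exprn_ge0// ltW.
have n1h : 8 * `|h| ^+ 4 <= n.+1%:R.
  apply: le_trans (_ : n%:R <= _); last by rewrite ler_nat.
  apply: le_trans hn; rewrite lerDl !mulr_ge0 ?exprn_ge0//.
  by rewrite invr_ge0 exprn_ge0// ltW.
have n1e : 2 ^+ 8 * `|cmul h h| / e ^+ 4 < n.+1%:R.
  apply: le_lt_trans (_ : n%:R < _); last by rewrite ltr_nat.
  by apply: le_trans hn; rewrite lerDr mulr_ge0 ?exprn_ge0.
have nN0 : n.+1%:R != 0 :> R[i] by rewrite pnatr_eq0.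
pose m := (n.+1 ^ 3)%N; pose r : R[i] := n.+1%:R^-1.
have r0 : 0 <= r by rewrite invr_ge0.
have m0 : (m%:R : R[i]) != 0 by rewrite pnatr_eq0 -lt0n expn_gt0.
pose q := m%:R^-1 *: \sum_(k < m) T r ^+ k.
have bq : poly_op_bound 2 q.
  have -> : 2 = `|m%:R^-1| * (2 *+ m) :> R[i].
    by rewrite ger0_norm ?invr_ge0// -[2 *+ m]mulr_natl mulKf.
  apply: poly_op_boundZ; apply: poly_op_bound_sum => k km.
  by apply: poly_op_boundT_expr => //; exact: ltnW.
have b1 : poly_op_bound (2 + 1) (T r ^+ m - 1).
  apply: poly_op_boundD; first exact: poly_op_boundT_expr.
  by have := poly_op_boundZ (-1) poly_op_bound1; rewrite normrN1 mul1r scaleN1r.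
(* The geometric sum telescopes against T r - 1 = -2 r^2 X^2, and 1/m = r^3 leaves one factor r. *)
have X2q : 'X^2 * q = (- r / 2) *: (T r ^+ m - 1).
  rewrite subrX1 /q -scalerAr.
  have -> : T r - 1 = - (2 * r ^+ 2) *: 'X^2 by rewrite /T scaleNr; ring.
  rewrite -scalerAl scalerA; congr (_ *: _).
  by rewrite /r /m natrX; field; rewrite nat1r pnatr_eq0.
have bX2q : poly_op_bound (2 * r) ('X^2 * q).
  rewrite X2q; apply: poly_op_boundW (poly_op_boundZ _ b1).
  rewrite normrM normrN !ger0_norm ?invr_ge0//.
  have -> : r / 2 * (2 + 1) = 3 / 2 * r :> R[i] by field.
  by rewrite ler_wpM2r// ler_pdivrMr ?ltr0Sn// -natrM ler_nat.
have cq : conjp q = q.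
  rewrite /conjp /q map_polyZ rmorph_sum /=.
  congr (_ *: _); first by apply: conjc_ge0; rewrite invr_ge0.
  by apply: eq_bigr => k _; rewrite rmorphXn; congr (_ ^+ _); exact: conj_polyT.
exists q; split => //.
  rewrite /q hornerZ horner_sum (eq_bigr (fun=> 1)) => [|k _].
    by rewrite sumr_const card_ord mulVf.
  by rewrite horner_exp hornerD hornerN hornerZ hornerXn -polyC1
    hornerC expr0n mulr0 subr0 expr1n.
(* Two uses of the C*-identity turn the fourth power of the norm into that of q^8 X^3 at h. One q
   joins X^2 to give the small factor, the other seven are bounded by 2 each, and the last X acts on
   the argument. *)
rewrite -(@ltr_pXn2r _ 4) ?nnegrE// ?(ltW e0)// (exprM _ 2 2).
rewrite sqr_norm_poly_op sqr_norm_poly_op.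
have cX : conjp 'X = 'X by exact: map_polyX.
have -> : conjp (conjp (q ^+ 2) * (q ^+ 2 * 'X)) *
      (conjp (q ^+ 2) * (q ^+ 2 * 'X) * 'X) =
    q ^+ 7 * ('X^2 * q) * 'X.
  by rewrite /conjp !(rmorphM, rmorphXn) /= -!/(conjp _) !cq cX; ring.
rewrite /ev poly_opMX.
have b7 : poly_op_bound (2 ^+ 7 * (2 * r)) (q ^+ 7 * ('X^2 * q)).
  apply: poly_op_boundM => //.
  exact: poly_op_boundXn.
apply: le_lt_trans (b7 _) _.
have -> : 2 ^+ 7 * (2 * r) * `|cmul h h| = 2 ^+ 8 * `|cmul h h| * r :> R[i].
  by ring.
by rewrite ltr_pdivrMr ?ltr0Sn// [ltRHS]mulrC -ltr_pdivrMr ?exprn_gt0.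
Qed.

End SelfAdjoint.

(** * Hilbert modules: inner product estimates and approximation by x<x,y> *)

Section HilbertModuleTheory.
Context {R : realType} {B : cstarAlgType R} {E : hilbertModType B}.
Implicit Types (x y z : E) (a b : B).

(** The swapped arguments make the action of a fixed [b] an operator on [E] to which [poly_op]
    applies. *)
Definition actr b x : E := act x b.

Lemma actr_linear b : linear (actr b).
Proof. by move=> c x y; rewrite /actr actDl actZl. Qed.

HB.instance Definition _ b :=
  GRing.isLinear.Build R[i] E E *:%R (actr b) (actr_linear b).

Lemma act_linear x : linear (act x : B -> E).
Proof. by move=> c a b; rewrite actDr actZr. Qed.

HB.instance Definition _ x :=
  GRing.isLinear.Build R[i] B E *:%R (act x) (act_linear x).

Lemma inner_linear x : linear (inner x).
Proof. by move=> c y z; rewrite innerDr innerZr. Qed.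

HB.instance Definition _ x :=
  GRing.isLinear.Build R[i] E B *:%R (inner x) (inner_linear x).

Lemma innerDl x y z : inner (x + y) z = inner x z + inner y z.
Proof. by rewrite -star_inner innerDr starD !star_inner. Qed.

Lemma innerZl (c : R[i]) x z : inner (c *: x) z = c^*%C *: inner x z.
Proof. by rewrite -star_inner innerZr starZ star_inner. Qed.

Lemma inner0l x : inner (0 : E) x = 0.
Proof. by rewrite -star_inner linear0 star0. Qed.

Lemma inner_actl x y b : inner (act x b) y = cmul (star b) (inner x y).
Proof. by rewrite -star_inner inner_act starM star_inner. Qed.

Lemma norm_act x b : `|act x b| <= `|x| * `|b|.
Proof.
rewrite -(@ler_pXn2r _ 2) ?nnegrE ?mulr_ge0// norm_inner inner_act inner_actl.
apply: le_trans (cnormM _ _) _; rewrite exprMn [leRHS]mulrC expr2 mulrAC.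
rewrite ler_wpM2r//; apply: le_trans (cnormM _ _) _.
by rewrite cnorm_starE norm_inner.
Qed.

Lemma inner_symE x y :
  inner x y + inner y x = inner (x + y) (x + y) - inner x x - inner y y.
Proof.
rewrite innerDl !innerDr [inner x x + _]addrC addrACA.
by rewrite -[RHS]addrA -opprD addrK.
Qed.

(* Polarization only yields this weak form of Cauchy-Schwarz, but it needs no
   order on [B]. *)
Lemma norm_inner_le x y : `|inner x y| <= 6 * (`|x| * `|y|).
Proof.
have norm_sq (u : E) : `|inner u u| = `|u| ^+ 2 by rewrite norm_inner.
(* The constant is 2^2 + 1 + 1, from |u + v| <= 2 and the two diagonal terms. *)
have sym (u v : E) : `|u| = 1 -> `|v| = 1 -> `|inner u v + inner v u| <= 6.
  move=> u1 v1; rewrite inner_symE; apply: le_trans (ler_normB _ _) _.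
  rewrite norm_sq v1 expr1n (_ : 6 = 5 + 1); last by ring.
  rewrite lerD2r; apply: le_trans (ler_normB _ _) _.
  rewrite !norm_sq u1 expr1n (_ : 5 = 2 ^+ 2 + 1); last by ring.
  rewrite lerD2r lerXn2r ?nnegrE//; apply: le_trans (ler_normD _ _) _.
  by rewrite u1 v1.
have unit (u v : E) : `|u| = 1 -> `|v| = 1 -> `|inner u v| <= 6.
  move=> u1 v1; have iv1 : `|'i *: v| = 1 by rewrite normrZ normCi v1 mulr1.
  (* The symmetric sums at v and iv recover <u,v>; both coefficients have modulus 1/2, so the
     constant stays 6. *)
  have -> : inner u v = 2^-1 *: (inner u v + inner v u) +
      (2^-1 * - 'i) *: (inner u ('i *: v) + inner ('i *: v) u).
    have conji : ('i : R[i])^*%C = - 'i by exact: (conjCi R[i]).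
    have ii : 'i * 'i = -1 :> R[i] by rewrite -expr2 sqrCi.
    rewrite innerZr innerZl conji !scalerDr !scalerA -!mulrA mulNr mulrNN ii.
    rewrite opprK mulrN1 mulr1 addrACA -scalerDl scaleNr addrN addr0.
    have -> : 2^-1 + 2^-1 = 1 :> R[i] by field.
    by rewrite scale1r.
  have i2 : `|2^-1| = 2^-1 :> R[i] by rewrite ger0_norm ?invr_ge0.
  apply: le_trans (ler_normD _ _) _; rewrite !normrZ normrM normrN normCi.
  rewrite mulr1 i2.
  rewrite -mulrDr ler_pdivrMl ?ltr0Sn// [2 * 6]mulrDl mul1r.
  by apply: lerD; apply: sym.
have [->|x0] := eqVneq x 0.
  by rewrite inner0l !normr0 mul0r mulr0.
have [->|y0] := eqVneq y 0; first by rewrite linear0 !normr0 !mulr0.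
have n1 (z : E) : z != 0 -> `| `|z|^-1 *: z| = 1.
  by move=> z0; rewrite normrZ normfV normr_id mulVf ?normr_eq0.
have := unit _ _ (n1 _ x0) (n1 _ y0).
rewrite innerZr innerZl (conjc_ge0 (x := `|x|^-1)) ?invr_ge0//.
rewrite scalerA normrZ normrM !normfV !normr_id -invfM.
by rewrite ler_pdivrMl ?mulr_gt0 ?normr_gt0// [_ * 6]mulrC [`|y| * _]mulrC.
Qed.

Let h x : B := inner x x.

Lemma inner_poly_op x p :
  inner x (poly_op (actr (h x)) p x) = poly_op (cmul (h x)) p (h x).
Proof.
rewrite /poly_op linear_sum; apply: eq_bigr => i _; rewrite linearZ /=.
congr (_ *: _); elim: (nat_of_ord i) => // n IH.
by rewrite iterS /actr inner_act IH iter_cmulr.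
Qed.

Lemma act_poly_op x p :
  act x (poly_op (cmul (h x)) p (h x)) = poly_op (actr (h x)) (p * 'X) x.
Proof.
rewrite poly_opMX /poly_op linear_sum; apply: eq_bigr => i _.
rewrite linearZ /=; congr (_ *: _); rewrite -iterSr.
have it n y : act y (iter n (cmul (h x)) (h x)) = iter n.+1 (actr (h x)) y.
  by elim: n y => // n IH y; rewrite iterS -actA IH [RHS]iterSr.
exact: it.
Qed.

Lemma sqr_norm_actr_poly x p : map_poly (@conjc R) p = p ->
  `|poly_op (actr (h x)) p x| ^+ 2 = `|poly_op (cmul (h x)) (p ^+ 2) (h x)|.
Proof.
move=> pc; have h_sa : star (h x) = h x by exact: star_inner.
rewrite norm_inner; set w := poly_op _ p x; congr `|_|.
have wz z : inner w z = poly_op (cmul (h x)) p (inner x z).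
  rewrite -[in RHS]pc poly_op_conjE /w {1}/poly_op.
  rewrite (big_morph (inner^~ z) (id1 := 0) (op1 := +%R)).
  - apply: eq_bigr => i _; rewrite innerZl; congr (_ *: _).
    elim: (nat_of_ord i) => // n IH.
    by rewrite iterS /actr inner_actl h_sa IH.
  - by move=> u v; rewrite innerDl.
  - exact: inner0l.
by rewrite wz /w inner_poly_op expr2 poly_opM.
Qed.

Lemma act_inner_dense x (e : R[i]) : 0 < e ->
  exists y, `|x - act x (inner x y)| < e.
Proof.
move=> e0.
have [q [qc q1 qe]] :=
  approx_unit_poly (star_inner x x) (exprn_gt0 2 e0).
have /factor_theorem[p qp] : root (1 - q) 0.
  by rewrite rootE hornerD hornerN q1 -polyC1 hornerC subrr.
exists (poly_op (actr (h x)) p x); rewrite inner_poly_op act_poly_op.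
have -> : p * 'X = 1 - q by rewrite qp subr0.
rewrite poly_opD poly_op1 -[- q]scaleN1r poly_opZ scaleN1r subKr.
by rewrite -(@ltr_pXn2r _ 2) ?nnegrE ?(ltW e0)// sqr_norm_actr_poly.
Qed.

End HilbertModuleTheory.

(** * Closed linear spans and closed preimages *)

Section ClosedSpan.
Context {K : numFieldType} {V : normedModType K}.
Implicit Types (A S : set V) (u v : V).

Lemma linear_subspaceP A : linear_subspace A <->
  A 0 /\ forall a u v, A u -> A v -> A (a *: u + v).
Proof.
split=> [[A0 Al]|[A0 Al]]; split.
- by move: A0; rewrite inE.
- by move=> a u v Au Av; have := Al a u v; rewrite !inE; apply.
- by rewrite inE.
- by move=> a u v; rewrite !inE; exact: Al.
Qed.

Lemma closure_normP A u : closure A u <->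
  forall e : K, 0 < e -> exists2 v, A v & `|u - v| < e.
Proof.
split=> [cA e e0|cA N /nbhs_ballP[e /= e0 eN]].
  have [v [Av]] := cA _ (nbhsx_ballx u e e0).
  by rewrite -ball_normE => uv; exists v.
have [v Av uv] := cA e e0; exists v; split => //; apply: eN.
by rewrite -ball_normE.
Qed.

Lemma lin_span_subspace S : linear_subspace (lin_span S).
Proof.
apply/linear_subspaceP; split=> [|a u v Su Sv] A [lA SA];
  have /linear_subspaceP[A0 Al] := lA; first exact: A0.
by apply: Al; [apply: Su|apply: Sv].
Qed.

Lemma closed_span_subspace S : linear_subspace (closed_span S).
Proof.
have /linear_subspaceP[S0 Sl] := lin_span_subspace S.
apply/linear_subspaceP; split=> [|a u v /closure_normP Su /closure_normP Sv].
  exact: subset_closure.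
apply/closure_normP => e e0.
(* Adding 1 keeps the divisor positive when [a] is 0. *)
have a1 : 0 < `|a| + 1 by rewrite ltr_wpDl.
have [u' Su' uu'] := Su _ (divr_gt0 (divr_gt0 e0 (ltr0Sn _ 1)) a1).
have [v' Sv' vv'] := Sv _ (divr_gt0 e0 (ltr0Sn _ 1)).
exists (a *: u' + v'); first exact: Sl.
rewrite opprD addrACA -scalerBr [ltRHS]splitr.
apply: le_lt_trans (ler_normD _ _) _; apply: ler_ltD => //.
rewrite normrZ; apply: (@le_trans _ _ ((`|a| + 1) * `|u - u'|)).
  by rewrite ler_wpM2r// lerDl.
by rewrite mulrC -ler_pdivlMr// ltW.
Qed.

Lemma sub_closed_span S : S `<=` closed_span S.
Proof. by move=> u Su; apply: subset_closure => A [_]; exact. Qed.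

(** This serves below as the induction principle for closed spans: a closed linear condition is
    checked on generators only. *)
Lemma closed_span_min S A : closed A -> linear_subspace A -> S `<=` A ->
  closed_span S `<=` A.
Proof.
move=> cA lA SA u Su; apply: cA; apply: closureS Su => v; apply.
by split.
Qed.

End ClosedSpan.

(** A Lipschitz condition, rather than linearity, also covers the map sending k to x<k,y>, which is
    conjugate-linear. *)
Lemma closed_preimage_lipschitz (K : numFieldType) (V W : normedModType K)
    (f : V -> W) (M : K) (A : set W) : 0 <= M ->
  (forall u v, `|f u - f v| <= M * `|u - v|) -> closed A ->
  closed (f @^-1` A).
Proof.
move=> M0 fM cA u /closure_normP uA; apply: cA; apply/closure_normP => e e0.
have M1 : 0 < M + 1 by rewrite ltr_wpDl.
have [v fv uv] := uA _ (divr_gt0 e0 M1); exists (f v) => //.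
apply: le_lt_trans (fM u v) _; move: uv; rewrite ltr_pdivlMr// mulrC.
by apply: le_lt_trans; rewrite ler_wpM2r// lerDl.
Qed.

(** * The algebra as a Hilbert module over itself, with <x,y> = x^* y *)

Definition self_module (R : realType) (B : cstarAlgType R) : Type := B.

Section SelfModule.
Context {R : realType} {B : cstarAlgType R}.
Implicit Types x y : self_module B.

HB.instance Definition _ := CompleteNormedModule.on (self_module B).

Let self_actA x (a b : B) :
  cmul (cmul x a) b = cmul x (cmul a b) :> self_module B.
Proof. by rewrite cmulA. Qed.

Let self_star_inner x y : star (cmul (star x) y) = cmul (star y) (x : B) :> B.
Proof. by rewrite starM starK. Qed.

Let self_inner_act x y (b : B) :
  cmul (star x) (cmul y b) = cmul (cmul (star x) y) b :> B.
Proof. by rewrite cmulA. Qed.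

Let self_inner_ge0 x : cpositive (cmul (star x) x : B).
Proof. by exists x. Qed.

Let self_norm_inner x : `|x| ^+ 2 = `|cmul (star x) x : B|.
Proof. by rewrite cnorm_star. Qed.

HB.instance Definition _ := isHilbertModule.Build R B (self_module B)
  self_actA (@cmulDl R B) (@cmulDr R B) (@cmulZl R B) (@cmulZr R B)
  (fun x => @cmulDr R B (star x)) (fun z x => @cmulZr R B z (star x))
  self_inner_act self_star_inner self_inner_ge0 self_norm_inner.

End SelfModule.

Lemma closed_ideal_star (R : realType) (B : cstarAlgType R) (I : set B) a :
  closed_ideal I -> I a -> I (star a).
Proof.
move=> [cI _ Il Ir] Ia; apply: cI; apply/closure_normP => e e0.
(* For x = a^* the approximant x<x,y> is a^* (a y), which contains the factor a and so lies in
   [I]. *)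
have [y ye] := act_inner_dense (E := self_module B) (star a) e0.
exists (cmul (star a) (cmul (star (star a)) y)) => //.
by rewrite starK; apply: Il; apply: Ir.
Qed.

(** * Ideal submodules versus closed ternary ideals *)

Section TernaryIdeals.
Context {R : realType} {B : cstarAlgType R} {E : hilbertModType B}.
Implicit Types (x y k : E) (b : B).

Lemma innerBl x y k : inner (x - y) k = inner x k - inner y k.
Proof. by rewrite innerDl -scaleN1r innerZl rmorphN1 scaleN1r. Qed.

Lemma closed_inner_preimage x y (A : set E) : closed A ->
  closed [set k | A (act x (inner k y))].
Proof.
apply: (@closed_preimage_lipschitz _ _ _ _ (`|x| * (6 * `|y|))).
  by rewrite !mulr_ge0.
move=> k k'; rewrite -linearB -innerBl; apply: le_trans (norm_act _ _) _.
rewrite -mulrA ler_wpM2l// -mulrA [`|y| * _]mulrC; exact: norm_inner_le.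
Qed.

Lemma ideal_submodule_ternary (K : set E) :
  ideal_submodule K -> ternary_ideal K.
Proof.
move=> [I cI ->]; have [_ _ Il Ir] := cI; set S := [set _ | _ in _ & _ in _].
have SK := closed_span_subspace S; split=> // x k y.
(* For fixed x and y the admissible k form a closed subspace, so only generators k = zb remain. *)
move: k; apply: closed_span_min.
- by apply: closed_inner_preimage; exact: closed_closure.
- have /linear_subspaceP[S0 Sl] := SK; apply/linear_subspaceP; split=> [|a u v].
    by rewrite /= inner0l linear0.
  by move=> Su Sv /=; rewrite innerDl innerZl linearD linearZ; exact: Sl.
- move=> _ [z _ [b Ib <-]] /=; apply: sub_closed_span.
  exists x => //; exists (inner (act z b) y) => //; rewrite inner_actl.
  by apply: Ir; exact: closed_ideal_star.
Qed.

Section ClosedTernary.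
Context (K : set E).
Context (cK : closed K) (tK : ternary_ideal K).

(** The element kb is a limit of k<k,y>b = k<k,yb>, and these lie in [K] by the ternary property. *)
Lemma ternary_ideal_act k b : K k -> K (act k b).
Proof.
move=> Kk; have [_ K3] := tK.
apply: (closed_preimage_lipschitz (f := actr b) (normr_ge0 b) _ cK).
  by move=> u v; rewrite -linearB mulrC; exact: norm_act.
apply/closure_normP => e e0; have [y ye] := act_inner_dense k e0.
by exists (act k (inner k y)); rewrite //= /actr actA -inner_act; exact: K3.
Qed.

Let I : set B := closed_span [set inner k y | k in K & y in [set: E]].

Let closed_ideal_I : closed_ideal I.
Proof.
have lI : linear_subspace I by exact: closed_span_subspace.
have /linear_subspaceP[I0 Il] := lI.
have cI : closed I by exact: closed_closure.
split=> // a b.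
- move: b; apply: closed_span_min.
  + apply: (closed_preimage_lipschitz (f := cmul a) (normr_ge0 a) _ cI).
    by move=> u v; rewrite -linearB; exact: cnormM.
  + apply/linear_subspaceP; split=> [|c u v Iu Iv] /=; first by rewrite linear0.
    by rewrite linearP; exact: Il.
  + move=> _ [k Kk [y _ <-]] /=; apply: sub_closed_span.
    (* Left multiplication moves into the first slot: a<k,y> = <k a^*, y>. *)
    exists (act k (star a)); first exact: ternary_ideal_act.
    by exists y => //; rewrite inner_actl starK.
- move: a; apply: closed_span_min.
  + apply: (closed_preimage_lipschitz (f := cmul^~ b) (normr_ge0 b) _ cI).
    move=> u v; rewrite mulrC; apply: le_trans (cnormM _ _).
    by rewrite cmulDl -[- v]scaleN1r cmulZl scaleN1r.
  + apply/linear_subspaceP; split=> [|c u v Iu Iv] /=; first by rewrite cmul0l.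
    by rewrite cmulDl cmulZl; exact: Il.
  + move=> _ [k Kk [y _ <-]] /=; apply: sub_closed_span.
    by exists k => //; exists (act y b) => //; rewrite inner_act.
Qed.

Lemma closed_ternary_ideal_submodule : ideal_submodule K.
Proof.
have [lK K3] := tK; have /linear_subspaceP[K0 Kl] := lK.
exists I => //; apply/seteqP; split=> [k Kk|].
  apply/closure_normP => e e0; have [y ye] := act_inner_dense k e0.
  exists (act k (inner k y)) => // A [_]; apply.
  exists k => //; exists (inner k y) => //; apply: sub_closed_span.
  by exists k => //; exists y.
(* For the other inclusion, the b with xb in [K] form a closed subspace for each x, and for b =
   <k,y> membership is the ternary property. *)
apply: closed_span_min => // _ [x _ [b + <-]]; move: b.
apply: closed_span_min.
- apply: (closed_preimage_lipschitz (f := act x) (normr_ge0 x) _ cK).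
  by move=> u v; rewrite -linearB; exact: norm_act.
- apply/linear_subspaceP; split=> [|c u v Ku Kv] /=; first by rewrite linear0.
  by rewrite linearP; exact: Kl.
- by move=> _ [k Kk [y _ <-]]; exact: K3.
Qed.

End ClosedTernary.

End TernaryIdeals.

Theorem propositionE (R : realType) (B : cstarAlgType R)
    (E : hilbertModType B) (K : set E) :
  ideal_submodule K <-> (closed K /\ ternary_ideal K).
Proof.
split=> [iK|[cK tK]]; last exact: closed_ternary_ideal_submodule.
split; last exact: ideal_submodule_ternary.
by have [I _ ->] := iK; exact: closed_closure.
Qed.
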